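(* Let $U,V,E_0,E_1$ be independent, with $\mathbb P(U=0)=\mathbb P(U=1)=\tfrac12$ and $V,E_0,E_1\sim\mathrm{Unif}(0,1)$, and let $T=\mathbf 1\{V\le p(U)\}$ with $p(0)=\tfrac15$, $p(1)=\tfrac45$. Model $M$ sets $Y(a)=Q_{a,U}(E_a)$ and model $M'$ sets $Y(a)=Q'_{a,U}(E_a)$ for $a\in\{0,1\}$; in both models $Y=(1-T)Y(0)+TY(1)$. The maps are, for $0\le e\le 1$, $$Q_{0,0}(e)=3e,\qquad Q_{0,1}(e)=\begin{cases}5e,&0\le e\le\frac15,\\ 1+\frac{10}{3}(e-\frac15),&\frac15<e\le\frac12,\\ 2+2(e-\frac12),&\frac12<e\le1,\end{cases}$$ $$Q_{1,0}(e)=\begin{cases}2e,&0\le e\le\frac12,\\ 2+2(e-\frac12),&\frac12<e\le1,\end{cases}\qquad Q_{1,1}(e)=\begin{cases}5e,&0\le e\le\frac15,\\ 2+\frac54(e-\frac15),&\frac15<e\le1,\end{cases}$$ $$Q'_{1,0}(e)=2+e,\qquad Q'_{1,1}(e)=\begin{cases}\frac{40}{13}e,&0\le e\le\frac{13}{40},\\ 2+\frac{40}{27}(e-\frac{13}{40}),&\frac{13}{40}<e\le1,\end{cases}$$ $$Q'_{0,0}(e)=\begin{cases}\frac{50}{19}e,&0\le e\le\frac{19}{50},\\ 1+5(e-\frac{19}{50}),&\frac{19}{50}<e\le\frac{29}{50},\\ 2+\frac{50}{21}(e-\frac{29}{50}),&\frac{29}{50}<e\le1,\end{cases}$$ $$Q'_{0,1}(e)=\begin{cases}75e,&0\le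 e\le\frac1{75},\\ 1+\frac65(e-\frac1{75}),&\frac1{75}<e\le\frac{127}{150},\\ 2+\frac{150}{23}(e-\frac{127}{150}),&\frac{127}{150}<e\le1.\end{cases}$$ Then $$\mathcal L_{M'}(T,Y)=\mathcal L_M(T,Y),\qquad \mathrm{ATE}(M')=\frac{117}{200}\ne\frac{3}{20}=\mathrm{ATE}(M).$$ Consequently, the observational law of $(T,Y)$ does not identify the ATE on the model class containing $M$ and $M'$.
   Context: $\mathrm{ATE}=\mathbb E[Y(1)]-\mathbb E[Y(0)]$ is the average treatment effect of a model. A quantity is not identified on a model class by the observational law if two models in the class have the same law of $(T,Y)$ but different values of the quantity. $\mathcal L_M(T,Y)$ denotes the joint law of $(T,Y)$ under model $M$. *)

(* Defs.v *)
(* Library: MathComp and MathComp-Analysis. *)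
From HB Require Import structures.
From mathcomp Require Import all_boot all_order all_algebra.
From mathcomp Require Import all_classical all_reals all_analysis.
From mathcomp Require Import measurable_realfun.

Set Implicit Arguments.
Unset Strict Implicit.
Unset Printing Implicit Defensive.

Import Order.TTheory GRing.Theory Num.Theory.
Import numFieldNormedType.Exports.

Local Open Scope classical_set_scope.
Local Open Scope ring_scope.

(* The values 0 and 1 of binary variables (treatment arms [a], [U], [T]) are
   [false] and [true]. *)

Section Independence.
Context d (Omega : measurableType d) (R : realType) (P : probability Omega R).

(* Mutual independence of a finite family of classes of events. *)
Definition independent_classes (I : finType) (F : I -> set (set Omega)) : Prop :=
  forall (J : {set I}) (A : I -> set Omega),
    (forall i, i \in J -> F i (A i)) ->
    P (\bigcap_(i in [set` J]) A i) = (\prod_(i in J) P (A i))%E.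

(* The sigma-algebra generated by a random variable. *)
Definition sigma_rv d' (S : measurableType d') (X : {RV P >-> S}) :
    set (set Omega) :=
  preimage_set_system setT X measurable.

End Independence.

Section Models.
Context (R : realType).

Record model := Model {
  model_display : measure_display;
  sample_space : measurableType model_display;
  model_prob : probability sample_space R;
  treatment : {RV model_prob >-> bool};
  potential_outcome : bool -> {RV model_prob >-> R}
}.

Definition observed_pair (M : model) (w : sample_space M) : bool * R :=
  let t : R := (treatment M w)%:R in
  (treatment M w,
   (1 - t) * potential_outcome M false w + t * potential_outcome M true w).

Lemma measurable_observed_pair (M : model) :
  measurable_fun setT (@observed_pair M).
Proof.
apply: measurable_fun_pair; first exact: measurable_funPT.
have mT : measurable_fun setT (fun w => (treatment M w)%:R : R).
  apply: (measurableT_comp (f := fun b : bool => b%:R : R)).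
    by move=> _ B _.
  exact: measurable_funPT.
by apply: measurable_funD; apply: measurable_funM => //;
  apply: measurable_funB.
Qed.

HB.instance Definition _ (M : model) :=
  isMeasurableFun.Build _ _ _ _ (@observed_pair M)
    (@measurable_observed_pair M).

Definition observational_law (M : model) : set (bool * R) -> \bar R :=
  distribution (model_prob M) (@observed_pair M).

(* Laws are compared on measurable sets only: the value of a measure on a
   non-measurable set is meaningless. *)
Definition same_observational_law (M1 M2 : model) : Prop :=
  forall A : set (bool * R), measurable A ->
    observational_law M1 A = observational_law M2 A.

Definition ATE (M : model) : \bar R :=
  ('E_(model_prob M)[potential_outcome M true]
   - 'E_(model_prob M)[potential_outcome M false])%E.

(* [model] quantifies over all sample spaces, so a class of models lives one
   universe too high to be a [set]. *)
Definition not_identified (C : model -> Prop) (S : Type) (q : model -> S) :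
    Prop :=
  exists M1 M2 : model,
    [/\ C M1, C M2, same_observational_law M1 M2 & q M1 <> q M2].

End Models.

Section StructuralModel.
Context d (Omega : measurableType d) (R : realType) (P : probability Omega R).
Variables (U : {RV P >-> bool}) (V : {RV P >-> R}) (E : bool -> {RV P >-> R}).
Variables (p : bool -> R) (Q : bool -> bool -> {mfun R >-> R}).

Definition threshold_treatment (w : Omega) : bool := V w <= p (U w).

Lemma measurable_threshold_treatment : measurable_fun setT threshold_treatment.
Proof.
apply: measurable_fun_ler => //.
by apply: (measurableT_comp (f := p)); [move=> _ B _ | exact: measurable_funPT].
Qed.

HB.instance Definition _ :=
  isMeasurableFun.Build _ _ _ _ threshold_treatment
    measurable_threshold_treatment.

Definition quantile_outcome (a : bool) (w : Omega) : R := Q a (U w) (E a w).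

Lemma measurable_quantile_outcome (a : bool) :
  measurable_fun setT (quantile_outcome a).
Proof.
rewrite (_ : quantile_outcome a = fun w =>
  if U w then Q a true (E a w) else Q a false (E a w)); last first.
  by apply/funext => w; rewrite /quantile_outcome; case: (U w).
apply: measurable_fun_ifT; first exact: measurable_funPT.
- by apply: measurableT_comp; exact: measurable_funPT.
- by apply: measurableT_comp; exact: measurable_funPT.
Qed.

HB.instance Definition _ (a : bool) :=
  isMeasurableFun.Build _ _ _ _ (quantile_outcome a)
    (measurable_quantile_outcome a).

Definition structural_model : model R :=
  @Model R d Omega P threshold_treatment quantile_outcome.

End StructuralModel.

Section QuantileMaps.
Context (R : realType).

Definition propensity (u : bool) : R := if u then 4 / 5 else 1 / 5.

(* Only the values on [0, 1] matter; each formula is extended to all of R by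
   its outermost affine pieces. *)
Definition Q_fun (a u : bool) (e : R) : R :=
  match a, u with
  | false, false => 3 * e
  | false, true =>
      if e <= 1 / 5 then 5 * e
      else if e <= 1 / 2 then 1 + 10 / 3 * (e - 1 / 5)
      else 2 + 2 * (e - 1 / 2)
  | true, false =>
      if e <= 1 / 2 then 2 * e else 2 + 2 * (e - 1 / 2)
  | true, true =>
      if e <= 1 / 5 then 5 * e else 2 + 5 / 4 * (e - 1 / 5)
  end.

Definition Q'_fun (a u : bool) (e : R) : R :=
  match a, u with
  | true, false => 2 + e
  | true, true =>
      if e <= 13 / 40 then 40 / 13 * e else 2 + 40 / 27 * (e - 13 / 40)
  | false, false =>
      if e <= 19 / 50 then 50 / 19 * e
      else if e <= 29 / 50 then 1 + 5 * (e - 19 / 50)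
      else 2 + 50 / 21 * (e - 29 / 50)
  | false, true =>
      if e <= 1 / 75 then 75 * e
      else if e <= 127 / 150 then 1 + 6 / 5 * (e - 1 / 75)
      else 2 + 150 / 23 * (e - 127 / 150)
  end.

Lemma measurable_Q_fun (a u : bool) : measurable_fun setT (Q_fun a u).
Proof.
by case: a; case: u; rewrite /Q_fun;
  repeat (apply: measurable_fun_ifT; first exact: measurable_fun_ler);
  repeat (apply: measurable_funD || apply: measurable_funM
          || apply: measurable_funB).
Qed.

Lemma measurable_Q'_fun (a u : bool) : measurable_fun setT (Q'_fun a u).
Proof.
by case: a; case: u; rewrite /Q'_fun;
  repeat (apply: measurable_fun_ifT; first exact: measurable_fun_ler);
  repeat (apply: measurable_funD || apply: measurable_funM
          || apply: measurable_funB).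
Qed.

HB.instance Definition _ (a u : bool) :=
  isMeasurableFun.Build _ _ _ _ (Q_fun a u) (measurable_Q_fun a u).

HB.instance Definition _ (a u : bool) :=
  isMeasurableFun.Build _ _ _ _ (Q'_fun a u) (measurable_Q'_fun a u).

Definition Q (a u : bool) : {mfun R >-> R} := Q_fun a u.

Definition Q' (a u : bool) : {mfun R >-> R} := Q'_fun a u.

End QuantileMaps.

(* Main.v *)
Require Import Defs.
From HB Require Import structures.
From mathcomp Require Import all_boot all_order all_algebra.
From mathcomp Require Import all_classical all_reals all_analysis.
From mathcomp Require Import measurable_realfun ring lra.

Set Implicit Arguments.
Unset Strict Implicit.
Unset Printing Implicit Defensive.

Import Order.TTheory GRing.Theory Num.Theory.
Import numFieldNormedType.Exports.

Local Open Scope classical_set_scope.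
Local Open Scope ring_scope.

(* Each quantile map sends a knot interval ]c_k, c_(k+1)] of ]0, 1] affinely onto
   ]k, k+1], so it pushes Unif(0, 1) forward to the mixture of the uniform laws
   on ]k, k+1] with weights c_(k+1) - c_k.  By independence the law of (T, Y)
   and the laws of Y(0) and Y(1) are mixtures of the same three uniform laws.
   In the former, u enters with weight P(U = u, T = t); in the latter, with
   weight P(U = u).  The maps of M and M' agree after averaging over u with the
   first weights but not with the second. *)

(** * Lebesgue measure under affine maps *)

(** The pushforward of Lebesgue measure under the affine map, scaled by [s], gives each half-open
    interval its length, so uniqueness of Lebesgue measure applies. *)
Lemma lebesgue_measure_affine (R : realType) (s t : R) (B : set R) :
  0 < s -> measurable B ->
  lebesgue_measure B =
  (s%:E * lebesgue_measure ((fun x => (s * x + t)%R) @^-1` B))%E.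
Proof.
move=> s0 mB.
pose phi (x : measurableTypeR R) : measurableTypeR R := s * x + t.
have mphi : measurable_fun setT phi.
  by apply: measurable_funD => //; apply: measurable_funM.
pose m : {measure set (measurableTypeR R) -> \bar R} :=
  mscale (NngNum (ltW s0)) (pushforward lebesgue_measure phi).
rewrite (@lebesgue_measure_unique R (m mphi))// => _ [[a b]] _ <-.
rewrite /m/= /mscale/= /pushforward.
rewrite (_ : _ @^-1` _ = `](a - t) / s, (b - t) / s]%classic); last first.
  apply/seteqP; split => x /=; rewrite /phi !in_itv/= ltr_pdivrMr// ler_pdivlMr//;
    by rewrite ltrBlDr lerBrDr mulrC.
rewrite !lebesgue_measure_itv/= !lte_fin ltr_pM2r ?invr_gt0// ltrD2r.
case: ifP => _; last by rewrite mule0.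
by rewrite -!EFinB -EFinM; congr EFin; field; rewrite gt_eqF.
Qed.

Definition unit_slab (R : realType) (k : nat) : set R := `]k%:R, k.+1%:R].

Lemma measurable_unit_slab (R : realType) (k : nat) :
  measurable (@unit_slab R k).
Proof. exact: measurable_itv. Qed.

(** The affine bijection from []a, b]] onto the slab has slope [(b - a)^-1], hence the factor
    [b - a]. *)
Lemma lebesgue_measure_affine_piece (R : realType) (a b : R) (k : nat)
    (B : set R) : a <= b -> measurable B ->
  lebesgue_measure
    ((fun x => k%:R + (x - a) / (b - a)) @^-1` B `&` `]a, b]) =
  ((b - a)%R%:E * lebesgue_measure (B `&` unit_slab k))%E.
Proof.
(* For [a = b] the piece is empty and the factor is 0, so both sides vanish whatever the quotient
   denotes. *)
rewrite le_eqVlt => /predU1P[->|ab] mB.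
  by rewrite set_itv_ge ?bnd_simp ?ltxx// setI0 measure0 subrr mul0e.
have ba0 : 0 < b - a by rewrite subr_gt0.
rewrite [in RHS](@lebesgue_measure_affine _ (b - a)^-1 (k%:R - a / (b - a)))//.
- rewrite muleA -EFinM divff ?gt_eqF// mul1e; congr (lebesgue_measure _).
  have E x : (b - a)^-1 * x + (k%:R - a / (b - a)) = k%:R + (x - a) / (b - a).
    by field; rewrite gt_eqF.
  apply/seteqP; split => x [] /=; rewrite /unit_slab /= !in_itv/= E => Bx /andP[h1 h2]; split => //.
    rewrite ltrDl divr_gt0 ?subr_gt0//= -natr1 lerD2l ler_pdivrMr// mul1r.
    by rewrite lerD2r.
  move: h1 h2; rewrite ltrDl -natr1 lerD2l pmulr_lgt0 ?invr_gt0// subr_gt0 => ->.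
  by rewrite ler_pdivrMr// mul1r lerD2r.
- by rewrite invr_gt0.
- by apply: measurableI => //; exact: measurable_unit_slab.
Qed.

Lemma lebesgue_measure_knots (R : realType) (c : nat -> R) (N : nat)
    (A : set R) : {homo c : m n / (m <= n)%N >-> m <= n} -> measurable A ->
  lebesgue_measure (A `&` `]c 0%N, c N]) =
  (\sum_(k < N) lebesgue_measure (A `&` `]c k, c k.+1]))%E.
Proof.
move=> nd_c mA; elim: N => [|N IH].
  by rewrite big_ord0 set_itv_ge ?bnd_simp ?ltxx// setI0 measure0.
rewrite big_ord_recr/= -IH -measureU/=; first last.
- apply/seteqP; split => // x [] [_] /=; rewrite in_itv/= => /andP[_ h] [_].
  by rewrite in_itv/= ltNge h.
- exact: measurableI.
- exact: measurableI.
- rewrite -setIUr; congr (lebesgue_measure (_ `&` _)).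
  by rewrite -itv_bndbnd_setU// bnd_simp; exact: nd_c.
Qed.

(** * Uniform laws and their images under slab quantile maps *)

(** The density lives on [[a, b]]; dropping the null point [a] leaves a half-open interval, and such
    intervals tile without overlap. *)
Lemma uniform_probE (R : realType) (a b : R) (ab : a < b) (A : set R) :
  measurable A ->
  uniform_prob ab A = ((b - a)^-1%:E * lebesgue_measure (A `&` `]a, b]))%E.
Proof.
move=> mA; rewrite /uniform_prob integral_uniform_pdf.
rewrite (eq_integral (fun=> (b - a)^-1%:E)); last first.
  move=> x; rewrite inE/= in_itv/= => -[_ xab].
  by rewrite /uniform_pdf xab.
rewrite integral_cst//=; last exact: measurableI.
congr (_ * _)%E.
rewrite (_ : `[a, b]%classic = [set a] `|` `]a, b]); last first.
  by rewrite -(setU1itv (x := a) (a := BRight b) false)// bnd_simp ltW.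
rewrite setIUr measureU//; [|exact: measurableI|exact: measurableI|]; last first.
  apply/seteqP; split => // x [] [_] /= ->; rewrite in_itv/= ltxx.
  by case.
rewrite [X in (X + _)%E](_ : _ = 0)%E ?add0e//.
apply: (@subset_measure0 _ _ _ lebesgue_measure _ [set a]) => //.
  exact: measurableI.
exact: lebesgue_measure_set1.
Qed.

Lemma uniform01E (R : realType) (A : set R) : measurable A ->
  uniform_prob (@ltr01 R) A = lebesgue_measure (A `&` `]0, 1]).
Proof. by move=> mA; rewrite uniform_probE// subr0 invr1 mul1e. Qed.

(* Steps with c k = c k.+1 are allowed: their piece is empty, so that the
   division by zero in the formula is never evaluated. *)
Definition slab_quantile (R : realType) (N : nat) (c : nat -> R)
    (f : R -> R) : Prop :=
  [/\ {homo c : m n / (m <= n)%N >-> m <= n}, c 0%N = 0, c N = 1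
    & forall (k : nat) (x : R), (k < N)%N -> c k < x <= c k.+1 ->
        f x = k%:R + (x - c k) / (c k.+1 - c k)].

Lemma uniform_slab_quantile (R : realType) (N : nat) (c : nat -> R)
    (f : {mfun R >-> R}) (B : set R) :
  slab_quantile N c f -> measurable B ->
  uniform_prob (@ltr01 R) (f @^-1` B) =
  (\sum_(k < N) (c k.+1 - c k)%R%:E * lebesgue_measure (B `&` unit_slab k))%E.
Proof.
move=> [nd_c c0 cN cf] mB.
have mf : measurable (f @^-1` B) by exact: measurable_funPTI.
(* The endpoints 0 and 1 are turned into the extreme knots, so that []0, 1]] can be cut along
   [c]. *)
rewrite uniform01E// -c0 -cN lebesgue_measure_knots//.
apply: eq_bigr => k _; rewrite -lebesgue_measure_affine_piece//; last exact: nd_c.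
congr (lebesgue_measure _); apply/seteqP.
by split => x [] /= Bx; rewrite in_itv/= => cx; split => //; move: Bx; rewrite (cf k).
Qed.

(** * Expectation of a mixture of uniform laws *)

Lemma integral_id_itv (R : realType) (a b : R) : a < b ->
  (\int[lebesgue_measure]_(x in `[a, b]) x%:E = ((b ^+ 2 - a ^+ 2) / 2)%:E)%E.
Proof.
move=> ab; pose F (x : R) : R := x ^+ 2 / 2.
have dF (x : R) : is_derive x 1 F x.
  rewrite /F; apply: is_derive_eq.
  by rewrite !scaler0 add0r /GRing.scale/=; field.
have cF (x : R) : {for x, continuous F}.
  by apply/differentiable_continuous/derivable1_diffP; case: (dF x).
rewrite (@continuous_FTC2 _ id F)//.
- by rewrite -EFinB -mulrBl.
- by apply: continuous_subspaceT => x; exact: cvg_id.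
- split.
  + by move=> x _; case: (dF x).
  + by apply: cvg_at_right_filter; exact: cF.
  + by apply: cvg_at_left_filter; exact: cF.
- by move=> x _; rewrite derive1E derive_val.
Qed.

(* [X'] is [X] with the sigma-algebra that [lebesgue_measure] carries; the two
   measurable structures on R have the same measurable sets but different
   types. *)
Lemma expectation_uniform_mixture d (Omega : measurableType d) (R : realType)
    (P : probability Omega R) (X : {RV P >-> R}) (N : nat) (w : nat -> R) :
  (forall k, 0 <= w k) ->
  (forall B, measurable B ->
    P (X @^-1` B) =
    (\sum_(k < N) (w k)%:E * lebesgue_measure (B `&` unit_slab k))%E) ->
  'E_P[X]%E = (\sum_(k < N) w k * (k%:R + 1 / 2))%:E.
Proof.
move=> w0 PX.
have ltk k : k%:R < k.+1%:R :> R by rewrite ltr_nat.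
pose m k : {measure set (measurableTypeR R) -> \bar R} :=
  mscale (NngNum (w0 k)) (uniform_prob (ltk k)).
pose X' : Omega -> measurableTypeR R := X.
have mX' : measurable_fun setT X' := measurable_funPT X.
(* Each slab has length one, so Lebesgue measure on it is already the uniform law. *)
have law A : measurable A -> pushforward P X' A = msum m N A.
  move=> mA; rewrite /pushforward [LHS]PX// /msum.
  apply: eq_bigr => k _; rewrite /m/= /mscale/= uniform_probE//.
  by rewrite -[k.+1]addn1 natrD addrAC subrr add0r invr1 mul1e /unit_slab -natr1.
have int_m (f : measurableTypeR R -> \bar R) :
    measurable_fun setT f -> (forall x, 0 <= f x)%E ->
    (\int[P]_x f (X x) =
     \sum_(k < N) (w k)%:E * \int[lebesgue_measure]_(x in `[k%:R, k.+1%:R]) f x)%E.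
  move=> mf f0.
  transitivity (\int[pushforward P X']_x f x)%E.
    by rewrite ge0_integral_pushforward.
  rewrite (eq_measure_integral (msum m N)); last by move=> A mA _; exact: law.
  rewrite ge0_integral_measure_sum//; apply: eq_bigr => k _.
  rewrite ge0_integral_mscale//= integral_uniform//; congr (_ * _)%E.
  by rewrite -natr1 addrAC subrr add0r invr1 mul1e.
(* The transfer formula [int_m] is for nonnegative integrands, so the positive and negative parts of
   [X] are integrated separately. *)
rewrite expectation_def integralE.
have -> : (\int[P]_x (fun w => (X w)%:E)^\+ x =
    \sum_(k < N) (w k * (k%:R + 1 / 2))%:E)%E.
  transitivity (\int[P]_w (EFin : R -> \bar R)^\+ (X w))%E.
    by apply: eq_integral => ? _; rewrite ?funeposE ?funenegE.
  rewrite int_m//; last first.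
    by apply: measurable_funepos; exact: EFin_measurable.
  apply: eq_bigr => k _; rewrite EFinM; congr (_ * _)%E.
  rewrite (eq_integral (fun x : measurableTypeR R => x%:E)); last first.
    move=> x; rewrite inE/= in_itv/= => /andP[kx _]; rewrite funeposE.
    by apply/max_idPl; rewrite lee_fin (le_trans _ kx).
  (* The mean of slab [k] is [((k + 1)^2 - k^2) / 2 = k + 1 / 2]. *)
  by rewrite integral_id_itv// -natr1; congr EFin; field.
(* All slabs lie in the nonnegative half-line, so the negative part integrates to 0. *)
have -> : (\int[P]_x (fun w => (X w)%:E)^\- x = 0)%E.
  transitivity (\int[P]_w (EFin : R -> \bar R)^\- (X w))%E.
    by apply: eq_integral => ? _; rewrite ?funeposE ?funenegE.
  rewrite int_m//; last first.
    by apply: measurable_funeneg; exact: EFin_measurable.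
  rewrite big1// => k _; rewrite integral0_eq ?mule0// => x.
  rewrite /= in_itv/= => /andP[kx _]; rewrite funenegE.
  by apply/max_idPr; rewrite lee_fin oppr_le0 (le_trans _ kx).
by rewrite sube0 sumEFin.
Qed.

(** * Laws of the observed pair and of the potential outcomes *)

Lemma probability_split_bool d (Omega : measurableType d) (R : realType)
    (P : probability Omega R) (X : {RV P >-> bool}) (A : set Omega) :
  measurable A -> P A = (\sum_(b : bool) P (A `&` X @^-1` [set b]))%E.
Proof.
move=> mA; have mX b : measurable (X @^-1` [set b]).
  exact: measurable_funPTI.
rewrite big_bool/= -measureU; try exact: measurableI.
- rewrite -setIUr; congr (P _); apply/seteqP; split => w //=; last by case.
  by move=> Aw; split => //; case: (X w); [left|right].
- by apply/seteqP; split => // w [[_ /= ->] [_ /=]].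
Qed.

Section StructuralLaws.
Context d (Omega : measurableType d) (R : realType) (P : probability Omega R).
Variables (U : {RV P >-> bool}) (V : {RV P >-> R}) (E : bool -> {RV P >-> R}).
Hypothesis indepUVE : independent_classes P
  (tnth [tuple sigma_rv U; sigma_rv V;
               sigma_rv (E false); sigma_rv (E true)]).

(** Independence of all four variables is applied with the sure event for the noise of the other
    arm, whose factor is 1. *)
Lemma probability_cell (a : bool) (A : set bool) (B C : set R) :
  measurable B -> measurable C ->
  P (U @^-1` A `&` V @^-1` B `&` E a @^-1` C) =
  (P (U @^-1` A) * P (V @^-1` B) * P (E a @^-1` C))%E.
Proof.
move=> mB mC.
pose D b : set R := if b == a then C else setT.
have mD b : measurable (D b) by rewrite /D; case: ifP.
pose F : 'I_4 -> set Omega := tnth [tuple U @^-1` A; V @^-1` B;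
  E false @^-1` D false; E true @^-1` D true].
have := @indepUVE [set: 'I_4]%SET F.
rewrite (_ : \bigcap_(i in _) F i = U @^-1` A `&` V @^-1` B `&` E a @^-1` C);
  last first.
  apply/seteqP; split => w.
    move=> Fw; have h i : F i w by apply: Fw; rewrite /= inE.
    split; first split.
    - exact: (h (@Ordinal 4 0 isT)).
    - exact: (h (@Ordinal 4 1 isT)).
    - case: a @D @F mD {Fw} h => D F mD h.
        by have := h (@Ordinal 4 3 isT).
      by have := h (@Ordinal 4 2 isT).
  move=> [[wA wB] wC] i _; case: a @D @F mD wC => D F mD wC;
    by case: i => [[|[|[|[|//]]]] i4].
rewrite (eq_bigl xpredT); last by move=> i; rewrite inE.
rewrite !big_ord_recl big_ord0 /= mule1 /F /tnth /=.
move=> ->.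
- rewrite -!muleA; congr (_ * (_ * _))%E.
  by case: a @D @F mD => D F mD; rewrite /D/= preimage_setT probability_setT
    ?mul1e ?mule1.
- move=> [[|[|[|[|//]]]] i4] _; rewrite /tnth/=.
  + by exists A => //; rewrite setTI.
  + by exists B => //; rewrite setTI.
  + by exists (D false) => //; rewrite setTI.
  + by exists (D true) => //; rewrite setTI.
Qed.

Hypothesis half_U : forall u, P (U @^-1` [set u]) = (1 / 2)%:E.
Hypothesis unif_V : forall A : set R, measurable A ->
  distribution P V A = uniform_prob (@ltr01 R) A.
Hypothesis unif_E : forall (a : bool) (A : set R), measurable A ->
  distribution P (E a) A = uniform_prob (@ltr01 R) A.

(** The conditional probability of [T = t] given [U = u]. *)
Definition arm_prob (p : bool -> R) (t u : bool) : R :=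
  if t then p u else 1 - p u.

(** With [u] fixed, the event concerns [V] alone and can serve as the [V]-factor of a cell. *)
Lemma probability_arm (p : bool -> R) (t u : bool) : 0 <= p u <= 1 ->
  P (V @^-1` [set v | (v <= p u) = t]) = (arm_prob p t u)%:E.
Proof.
move=> /andP[p0 p1].
have PV : P (V @^-1` `]-oo, p u]) = (p u)%:E.
  transitivity (distribution P V `]-oo, p u]) => //.
  rewrite unif_V// uniform01E//.
  rewrite (_ : _ `&` _ = `]0, p u]%classic).
    rewrite lebesgue_measure_itv/= lte_fin sube0.
    by move: p0; rewrite le_eqVlt => /predU1P[<-|->]; rewrite ?ltxx.
  apply/seteqP; split => x /=; rewrite !in_itv/=.
    by move=> [-> /andP[-> _]].
  by move=> /andP[-> xp]; rewrite xp (le_trans xp).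
case: t; rewrite /arm_prob.
  by rewrite -PV; congr (P _); apply/seteqP; split => w /=; rewrite in_itv.
rewrite EFinB -PV -probability_setC; last exact: measurable_funPTI.
congr (P _); apply/seteqP; split => w /=; rewrite in_itv/=.
  by move=> ->.
by move=> /negP/negbTE.
Qed.

Variables (p : bool -> R) (Q : bool -> bool -> {mfun R >-> R}).
Variables (N : nat) (c : bool -> bool -> nat -> R).
Hypothesis p01 : forall u, 0 <= p u <= 1.
Hypothesis Qc : forall a u, slab_quantile N (c a u) (Q a u).

Let weight_ge0 a u k : 0 <= c a u k.+1 - c a u k.
Proof. by rewrite subr_ge0; have [nd_c _ _ _] := Qc a u; exact: nd_c. Qed.

(** The weights [q] are left free to serve both [P(U = u, T = t)], for the observed pair, and
    [P(U = u)], for a potential outcome. *)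
Lemma uniform_quantile_mixture (a : bool) (q : bool -> R) (B : set R) :
  (forall u, 0 <= q u) -> measurable B ->
  (\sum_(u : bool) (q u)%:E * uniform_prob (@ltr01 R) (Q a u @^-1` B) =
   \sum_(k < N) (\sum_(u : bool) q u * (c a u k.+1 - c a u k))%R%:E *
     lebesgue_measure (B `&` unit_slab k))%E.
Proof.
move=> q0 mB.
under eq_bigr => u _.
  rewrite (uniform_slab_quantile (Qc a u))// ge0_sume_distrr; last first.
    by move=> k _; rewrite mule_ge0// lee_fin.
  over.
rewrite exchange_big/=; apply: eq_bigr => k _.
rewrite -sumEFin ge0_sume_distrl; last first.
  by move=> u _; rewrite lee_fin mulr_ge0.
by apply: eq_bigr => u _; rewrite EFinM muleA.
Qed.

Lemma observed_pair_structural (w : Omega) :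
  let t := threshold_treatment U V p w in
  observed_pair (M := structural_model U V E p Q) w = (t, Q t (U w) (E t w)).
Proof.
rewrite /observed_pair/= /quantile_outcome.
by case: threshold_treatment => /=; congr (_, _); ring.
Qed.

(** On the cell [T = t], [U = u] the observed outcome is [Q t u (E t)], so the event splits into
    conditions on [U], [V] and [E t] separately, and independence factors its probability. *)
Lemma observational_lawE (A : set (bool * R)) : measurable A ->
  observational_law (structural_model U V E p Q) A =
  (\sum_(t : bool) \sum_(k < N)
     (\sum_(u : bool) 1 / 2 * arm_prob p t u * (c t u k.+1 - c t u k))%R%:E *
     lebesgue_measure (xsection A t `&` unit_slab k))%E.
Proof.
move=> mA; pose M := structural_model U V E p Q.
have mAt t : measurable (xsection A t) by exact: measurable_xsection.
transitivity (P (observed_pair (M := M) @^-1` A)) => //.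
rewrite (@probability_split_bool _ _ _ _ (treatment M)); last first.
  by rewrite -[X in measurable X]setTI; exact: measurable_observed_pair.
apply: eq_bigr => t _.
rewrite -(@uniform_quantile_mixture t (fun u => 1 / 2 * arm_prob p t u))//; last first.
  move=> u; have /andP[p0 p1] := p01 u.
  by rewrite mulr_ge0 ?divr_ge0// /arm_prob; case: t; rewrite ?subr_ge0.
rewrite (probability_split_bool U); last first.
  apply: measurableI; last exact: measurable_funPTI.
  by rewrite -[X in measurable X]setTI; exact: measurable_observed_pair.
apply: eq_bigr => u _.
rewrite EFinM -(half_U u) -probability_arm// -(unif_E t); last exact: measurable_funPTI.
rewrite -probability_cell//; last 2 first.
- rewrite -[X in measurable X]setTI.
  have mle : measurable_fun setT (fun v : R => v <= p u).
    exact: measurable_fun_ler.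
  exact: (mle measurableT [set t]).
- exact: measurable_funPTI.
congr (P _); apply/seteqP; split => w /=; rewrite /xsection/= inE.
  move=> [[]]; rewrite observed_pair_structural => + tw uw.
  by rewrite tw uw => Aw; do 2!split => //; rewrite -tw /threshold_treatment uw.
move=> [[uw tw]] Aw; rewrite observed_pair_structural uw.
by rewrite (_ : threshold_treatment U V p w = t)// /threshold_treatment uw.
Qed.

Lemma quantile_outcomeE (a : bool) (B : set R) : measurable B ->
  P (quantile_outcome U E Q a @^-1` B) =
  (\sum_(k < N)
     (\sum_(u : bool) 1 / 2 * (c a u k.+1 - c a u k))%R%:E *
     lebesgue_measure (B `&` unit_slab k))%E.
Proof.
move=> mB; rewrite -(@uniform_quantile_mixture a (fun=> 1 / 2)) => //.
rewrite (probability_split_bool U); last exact: measurable_funPTI.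
apply: eq_bigr => u _.
rewrite -(half_U u) -(unif_E a); last exact: measurable_funPTI.
(* The whole line as the set for [V] leaves the treatment unconstrained. *)
have := @probability_cell a [set u] setT (Q a u @^-1` B).
rewrite preimage_setT setIT probability_setT mule1 => <-//; last exact: measurable_funPTI.
congr (P _); apply/seteqP; split => w /=; rewrite /quantile_outcome.
  by move=> [+ uw]; rewrite uw.
by move=> [uw]; rewrite uw.
Qed.

Lemma expectation_quantile_outcome (a : bool) :
  'E_P[quantile_outcome U E Q a]%E =
  (\sum_(k < N) (\sum_(u : bool) 1 / 2 * (c a u k.+1 - c a u k)) *
     (k%:R + 1 / 2))%:E.
Proof.
pose w k := \sum_(u : bool) 1 / 2 * (c a u k.+1 - c a u k).
apply: (expectation_uniform_mixture (w := w)) => [k|B]; last exact: quantile_outcomeE.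
by apply: sumr_ge0 => u _; rewrite mulr_ge0// divr_ge0.
Qed.

End StructuralLaws.

(** * Knots of the given quantile maps *)

(** The default 1 of [nth] supplies the last knot, at index 3, and keeps the sequence constant
    afterwards, hence monotone on all of [nat]. *)
Definition knots3 (R : realType) (c1 c2 : R) (k : nat) : R :=
  nth 1 [:: 0; c1; c2] k.

Lemma slab_quantile_knots3 (R : realType) (c1 c2 : R) (f : R -> R) :
  0 <= c1 -> c1 <= c2 -> c2 <= 1 ->
  (forall x, 0 < x <= c1 -> f x = x / c1) ->
  (forall x, c1 < x <= c2 -> f x = 1 + (x - c1) / (c2 - c1)) ->
  (forall x, c2 < x <= 1 -> f x = 2 + (x - c2) / (1 - c2)) ->
  slab_quantile 3 (knots3 c1 c2) f.
Proof.
move=> c10 c12 c21 f0 f1 f2; split => //.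
  apply: homo_leq => //; first exact: le_trans.
  by case=> [|[|[|k]]]; rewrite /knots3//= nth_nil.
move=> [|[|[|//]]] x _ /=; [|exact: f1|exact: f2].
by move=> /f0 ->; rewrite add0r !subr0.
Qed.

(** A repeated knot encodes a jump over the middle slab []1, 2]], which then has weight 0. *)
Definition Q_knots (R : realType) (a u : bool) : nat -> R :=
  match a, u with
  | false, false => knots3 (1 / 3) (2 / 3)
  | false, true => knots3 (1 / 5) (1 / 2)
  | true, false => knots3 (1 / 2) (1 / 2)
  | true, true => knots3 (1 / 5) (1 / 5)
  end.

(** The knots [0, 0] encode [2 + e], whose whole mass lies in the top slab. *)
Definition Q'_knots (R : realType) (a u : bool) : nat -> R :=
  match a, u with
  | false, false => knots3 (19 / 50) (29 / 50)
  | false, true => knots3 (1 / 75) (127 / 150)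
  | true, false => knots3 0 0
  | true, true => knots3 (13 / 40) (13 / 40)
  end.

Lemma Q_slab_quantile (R : realType) (a u : bool) :
  slab_quantile 3 (@Q_knots R a u) (@Q R a u).
Proof.
by case: a; case: u; apply: slab_quantile_knots3 => [|||x|x|x]; try lra;
  move=> /andP[? ?]; rewrite /Q/= /Q_fun; repeat case: lerP => ?; (lra || field).
Qed.

Lemma Q'_slab_quantile (R : realType) (a u : bool) :
  slab_quantile 3 (@Q'_knots R a u) (@Q' R a u).
Proof.
by case: a; case: u; apply: slab_quantile_knots3 => [|||x|x|x]; try lra;
  move=> /andP[? ?]; rewrite /Q'/= /Q'_fun; repeat case: lerP => ?; (lra || field).
Qed.

Lemma propensity01 (R : realType) (u : bool) : 0 <= @propensity R u <= 1.
Proof. by rewrite /propensity; case: u; lra. Qed.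

(** * Comparison of the two models *)

Theorem proposition30 :
  forall (R : realType) (d : measure_display) (Omega : measurableType d)
    (P : probability Omega R)
    (U : {RV P >-> bool}) (V : {RV P >-> R}) (E : bool -> {RV P >-> R}),
  independent_classes P
    (tnth [tuple sigma_rv U; sigma_rv V;
                 sigma_rv (E false); sigma_rv (E true)]) ->
  P [set w | U w = false] = (1 / 2)%:E ->
  P [set w | U w = true] = (1 / 2)%:E ->
  (forall A : set R, measurable A ->
     distribution P V A = uniform_prob (@ltr01 R) A) ->
  (forall (a : bool) (A : set R), measurable A ->
     distribution P (E a) A = uniform_prob (@ltr01 R) A) ->
  let M := structural_model U V E (@propensity R) (@Q R) in
  let M' := structural_model U V E (@propensity R) (@Q' R) in
  [/\ same_observational_law M' M,
      ATE M' = (117 / 200)%:E,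
      (117 / 200)%:E <> (3 / 20)%:E :> \bar R,
      ATE M = (3 / 20)%:E
    & forall C : model R -> Prop, C M -> C M' ->
        not_identified C (@ATE R)].
Proof.
move=> R d Omega P U V E indep U0 U1 unifV unifE M M'.
have half_U u : P (U @^-1` [set u]) = (1 / 2)%:E by case: u.
have ATE_M : ATE M = (3 / 20)%:E.
  rewrite /ATE (expectation_quantile_outcome indep half_U unifE
    (@Q_slab_quantile R) true).
  rewrite (expectation_quantile_outcome indep half_U unifE
    (@Q_slab_quantile R) false).
  rewrite -EFinB; congr EFin.
  (* With slab means 1/2, 3/2, 5/2 the expectations are 9/5 for the treated arm and 33/20 for the
     untreated one. *)
  by rewrite !big_ord_recl !big_ord0 !big_bool/= /bump /knots3/=; lra.
have ATE_M' : ATE M' = (117 / 200)%:E.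
  rewrite /ATE (expectation_quantile_outcome indep half_U unifE
    (@Q'_slab_quantile R) true).
  rewrite (expectation_quantile_outcome indep half_U unifE
    (@Q'_slab_quantile R) false).
  rewrite -EFinB; congr EFin.
  (* Here the two expectations are 87/40 and 159/100. *)
  by rewrite !big_ord_recl !big_ord0 !big_bool/= /bump /knots3/=; lra.
have law_eq : same_observational_law M' M.
  move=> A mA.
  rewrite (observational_lawE indep half_U unifV unifE (@propensity01 R)
    (@Q'_slab_quantile R))//.
  rewrite (observational_lawE indep half_U unifV unifE (@propensity01 R)
    (@Q_slab_quantile R))//.
  (* It suffices to match the slab weights: both models give 13/100, 0, 37/100 for [T = 1] and
     23/150, 49/300, 11/60 for [T = 0]. *)
  apply: eq_bigr => t _; apply: eq_bigr => k _; congr (_%:E * _)%E.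
  rewrite !big_bool/= /arm_prob /propensity.
  by case: t; case: k => [[|[|[|//]]] k3]; rewrite /= /knots3/=; field.
have ATE_neq : (117 / 200)%:E <> (3 / 20)%:E :> \bar R by move=> []; lra.
split => // C CM CM'; exists M', M; split => //.
by rewrite ATE_M ATE_M'.
Qed.
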